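(* Let $R$ be a commutative ring, let $q$ be an indeterminate, and let $S$ be the antipode of the connected graded Hopf algebra $\mathtt{QSym}_{q}$ over $R[q]$. Then for every $n\geq0$ and every composition $\alpha\vDash n$ we have $$S(F_{\alpha,q})=(-1)^{n}F_{\alpha^{t},q}\qquad\text{and}\qquad S(M_{\alpha,q})=(-1)^{\ell(\alpha)}E_{\alpha^{r},q}.$$
   Context: Compositions. A composition $\alpha\vDash n$ of an integer $n\geq0$ is a finite sequence $(\alpha_{1},\ldots,\alpha_{\ell})$ of positive integers summing to $n$; $\ell(\alpha)=\ell$ is its length, and $\emptyset$ is the only composition of $0$. Put $\mathbb{N}_{n-1}=\{1,\ldots,n-1\}$. For $n\geq1$, $\operatorname{comp}_{n}$ is the bijection from subsets of $\mathbb{N}_{n-1}$ to compositions of $n$ that takes $T=\{t_{1}<\cdots<t_{\ell-1}\}$ to the composition of length $\ell$ whose $j$th entry is $t_{j}-t_{j-1}$, where $t_{0}=0$ and $t_{\ell}=n$. For compositions $\alpha,\beta$ of the same $n$, $\beta\preceq\alpha$ (equivalently $\alpha\succeq\beta$) means that $\beta$ refines $\alpha$, i.e., $\beta$ is the concatenation, in order, of compositions of $\alpha_{1},\ldots,\alpha_{\ell}$. The reversal $\alpha^{r}$ is $\alpha$ written in the opposite order. If $\alpha=\operatorname{comp}_{n}T$ then the transpose is $\alpha^{t}=\operatorname{comp}_{n}\{n-t\;|\;t\in\mathbb{N}_{n-1}\setminus T\}$; also $\emptyset^{r}=\emptyset^{t}=\emptyset$. The algebra $\mathtt{QSym}_{q}$.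 It is the free $R[q]$-module with basis elements $M_{\alpha,q}$, with $\alpha$ running over all compositions, where $M_{\alpha,q}$ has degree $n$ if $\alpha\vDash n$. The unit is $M_{\emptyset,q}=1$, and the co-unit sends $M_{\emptyset,q}$ to $1$ and $M_{\alpha,q}$ to $0$ for $\alpha\neq\emptyset$. For an integer $a\geq1$ let $l_{a}$ be the $R[q]$-linear map taking $M_{\gamma,q}$ to $M_{(a,\gamma),q}$, where $(a,\gamma)$ is $\gamma$ with $a$ added as a first entry. For non-empty $\alpha=(\alpha_{1},\bar{\alpha})$ and $\beta=(\beta_{1},\bar{\beta})$ the product is defined recursively by $$M_{\alpha,q}M_{\beta,q}=l_{\alpha_{1}}(M_{\bar{\alpha},q}M_{\beta,q})+l_{\beta_{1}}(M_{\alpha,q}M_{\bar{\beta},q})+q\,l_{\alpha_{1}+\beta_{1}}(M_{\bar{\alpha},q}M_{\bar{\beta},q}).$$ The co-multiplication is $\Delta(M_{\alpha,q})=\sum_{k=0}^{\ell(\alpha)}M_{(\alpha_{1},\ldots,\alpha_{k}),q}\otimes M_{(\alpha_{k+1},\ldots,\alpha_{\ell(\alpha)}),q}$. This is a connected graded bi-algebra, hence a Hopf algebra; its antipode is the two-sided convolution inverse of the identity map. For $\alpha\vDash n$ set $F_{\alpha,q}=\sum_{\beta\preceq\alpha}q^{n-\ell(\beta)}M_{\beta,q}$ and $E_{\alpha,q}=\sum_{\beta\succeq\alpha}q^{\ell(\alpha)-\ell(\beta)}M_{\beta,q}$. *)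

(* Defs.v *)
From HB Require Import structures.
From mathcomp Require Import all_boot all_order all_algebra.
From mathcomp Require Import finmap zify.
From mathcomp Require Export monalg.

Set Implicit Arguments.
Unset Strict Implicit.
Unset Printing Implicit Defensive.

Import GRing.Theory.

Local Open Scope ring_scope.
Local Open Scope fset_scope.

Record posnat := PosNat { posnat_val :> nat; _ : (0 < posnat_val)%N }.
HB.instance Definition _ := [isSub for posnat_val].
HB.instance Definition _ := [Countable of posnat by <:].

Fact addp_subproof (a b : posnat) : (0 < a + b)%N.
Proof. by case: a => a a0; rewrite addn_gt0 a0. Qed.
Definition addp (a b : posnat) : posnat := PosNat (addp_subproof a b).

(* Length, reversal and the empty composition are [size], [rev], [[::]]. *)
Definition composition := seq posnat.

Definition weight (al : composition) : nat := sumn (map posnat_val al).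

Definition Nset (n : nat) : {fset nat} := [fset t in iota 1 n.-1].

(* The differences [t_j - t_(j-1)], with [t_0 = 0] and [t_l = n], of the
   increasing enumeration of [T] inside {1, ..., n-1}.  They are all positive
   when [0 < n], in which case [pmap insub] only retypes them; when [n = 0]
   the only difference is 0, and the result is the empty composition. *)
Definition comp_of_set (n : nat) (T : {fset nat}) : composition :=
  pmap insub (pairmap (fun x y => y - x)%N 0%N
                (rcons [seq t <- iota 1 n.-1 | t \in T] n)).

(* The inverse of [comp_of_set n]; see [set_of_compK] and [comp_of_setK]. *)
Definition set_of_comp (al : composition) : {fset nat} :=
  [fset weight (take j al) | j in iota 1 (size al).-1].

Definition compositions (n : nat) : seq composition :=
  [seq comp_of_set n T | T <- fpowerset (Nset n)].

Definition transpose (al : composition) : composition :=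
  let n := weight al in
  comp_of_set n [fset (n - t)%N | t in Nset n `\` set_of_comp al].

(* All concatenations of compositions of the successive entries. *)
Definition refinements (al : composition) : seq composition :=
  foldr (fun (a : posnat) cs => [seq b ++ c | b <- compositions a, c <- cs])
        [:: [::]] al.

Definition refines (be al : composition) : bool := be \in refinements al.

Section CompositionTheory.
Implicit Types (al be : composition) (n : nat) (T : {fset nat}).

Let posnat_val_inj : injective posnat_val := val_inj.
Let seqT n T := rcons [seq t <- iota 1 n.-1 | t \in T] n.
Let diffs := pairmap (fun x y => y - x)%N.

Lemma comp0 T : comp_of_set 0 T = [::].
Proof. by rewrite /comp_of_set /= insubF. Qed.

Lemma mem_Nset n t : (t \in Nset n) = (0 < t < n)%N.
Proof. by rewrite !inE mem_iota; case: n => [|n] /=; lia. Qed.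

Lemma weight_cons (a : posnat) al : weight (a :: al) = (a + weight al)%N.
Proof. by []. Qed.

Lemma weight_cat al be : weight (al ++ be) = (weight al + weight be)%N.
Proof. by rewrite /weight map_cat sumn_cat. Qed.

Let seqT_path n T : (0 < n)%N -> path ltn 0 (seqT n T).
Proof.
move=> n0; rewrite /seqT rcons_path; apply/andP; split.
  apply: (path_filter (@ltn_trans)).
  by rewrite -[path _ _ _]/(sorted ltn (iota 0 n.-1.+1)) iota_ltn_sorted.
have := mem_last 0%N [seq t <- iota 1 n.-1 | t \in T].
rewrite inE mem_filter mem_iota => /orP[/eqP->//|/andP[_ /andP[_]]].
by rewrite add1n prednK.
Qed.

Let val_pmap x s : path ltn x s ->
  map posnat_val (pmap insub (diffs x s)) = diffs x s.
Proof.
elim: s x => //= y s IHs x /andP[xy ys].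
have yx : (0 < y - x)%N by rewrite subn_gt0.
have -> : insub (y - x)%N = Some (PosNat yx) by exact: insubT.
by rewrite /= IHs.
Qed.

Let val_comp n T : (0 < n)%N ->
  map posnat_val (comp_of_set n T) = diffs 0 (seqT n T).
Proof. by move=> n0; apply/val_pmap/seqT_path. Qed.

Let scanl_diffs x s : path ltn x s -> scanl addn x (diffs x s) = s.
Proof.
elim: s x => //= y s IHs x /andP[xy ys].
by rewrite subnKC ?(ltnW xy) // IHs.
Qed.

Let scanlE x al : scanl addn x (map posnat_val al) =
   [seq (x + weight (take j al))%N | j <- iota 1 (size al)].
Proof.
elim: al x => //= a al IHal x; rewrite IHal take0 weight_cons addn0.
congr (_ :: _); rewrite (iotaDl 1 1) -map_comp; apply: eq_map => j /=.
by rewrite weight_cons addnA.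
Qed.

Let scanl_path x al : path ltn x (scanl addn x (map posnat_val al)).
Proof.
elim: al x => //= a al IHal x; rewrite IHal andbT.
by case: a => a a0 /=; rewrite -[X in (X < _)%N]addn0 ltn_add2l.
Qed.

Let psum al := [seq weight (take j al) | j <- iota 1 (size al).-1].

Let scanl_psum al : al != [::] ->
  scanl addn 0%N (map posnat_val al) = rcons (psum al) (weight al).
Proof.
case: al => // a al _; rewrite scanlE /psum.
have -> : iota 1 (size (a :: al)) = rcons (iota 1 (size al)) (size al).+1.
  by have := iotaD 1 (size al) 1; rewrite addn1 add1n cats1.
by rewrite map_rcons -[(size al).+1]/(size (a :: al)) take_size.
Qed.

Let psum_filter al : al != [::] ->
  [seq t <- iota 1 (weight al).-1 | t \in set_of_comp al] = psum al.
Proof.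
move=> al0; have := scanl_path 0 al; rewrite scanl_psum // => p.
have srt : sorted ltn (psum al).
  by move: p; rewrite rcons_path => /andP[/path_sorted].
apply: (irr_sorted_eq ltn_trans ltnn) => //.
  by apply: sorted_filter; [exact: ltn_trans | exact: iota_ltn_sorted].
move=> t; rewrite mem_filter; apply/andP/idP => [[/imfsetP[j /= jP ->] _]|tp].
  exact: map_f.
split; first by case/mapP: tp => j jP ->; apply/imfsetP; exists j.
have /allP a0 := order_path_min ltn_trans p.
have t0 := a0 t (_ : t \in rcons _ _).
rewrite mem_iota [(1 <= t)%N]t0 ?mem_rcons ?inE ?tp ?orbT //=.
move: (path_sorted p); rewrite sorted_pairwise; last exact: ltn_trans.
rewrite pairwise_rcons => /andP[/allP /(_ t tp) /= tw _].
by rewrite add1n prednK // (leq_trans _ tw).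
Qed.

Lemma weight_eq0 al : (weight al == 0%N) = (al == [::]).
Proof. by case: al => [|[[]]]. Qed.

Lemma set_of_compK al : comp_of_set (weight al) (set_of_comp al) = al.
Proof.
case: (eqVneq al [::]) => [->|al0]; first exact: comp0.
have wal : (0 < weight al)%N by rewrite lt0n weight_eq0.
apply: (inj_map posnat_val_inj).
rewrite val_comp //.
rewrite -[RHS](scanlK addKn 0%N).
congr pairmap; rewrite scanl_psum // /seqT; congr rcons.
exact: psum_filter.
Qed.

Lemma comp_of_setK n T : (0 < n)%N -> T `<=` Nset n ->
  set_of_comp (comp_of_set n T) = T.
Proof.
move=> n0 /fsubsetP sT.
have c0 : comp_of_set n T != [::].
  rewrite -(inj_eq (inj_map posnat_val_inj)) val_comp // /diffs /seqT.
  by case: filter.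
have := scanl_psum c0; rewrite val_comp // scanl_diffs ?seqT_path //.
move/rcons_inj => [fE _]; apply/fsetP => t; apply/idP/idP.
  case/imfsetP => j /= jP ->; suff: weight (take j (comp_of_set n T)) \in
    [seq t0 <- iota 1 n.-1 | t0 \in T] by rewrite mem_filter => /andP[].
  by rewrite fE; apply: map_f.
move=> tT; have : t \in [seq t0 <- iota 1 n.-1 | t0 \in T].
  by rewrite mem_filter tT /=; have := sT t tT; rewrite !inE.
by rewrite fE => /mapP[j jP ->]; apply/imfsetP; exists j.
Qed.

Lemma weight_comp_of_set n T : weight (comp_of_set n T) = n.
Proof.
case: n => [|n]; first by rewrite comp0.
have n0 := ltn0Sn n; set al := comp_of_set _ T.
have al0 : al != [::].
  rewrite -(inj_eq (inj_map posnat_val_inj)) val_comp // /diffs /seqT.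
  by case: filter.
have := scanl_psum al0; rewrite val_comp // scanl_diffs ?seqT_path //.
by case/rcons_inj => _ <-.
Qed.

Lemma uniq_compositions n : uniq (compositions n).
Proof.
rewrite map_inj_in_uniq ?fset_uniq // => T U.
rewrite !fpowersetE; case: n => [|n] sT sU.
  have N0 : Nset 0 = fset0 by apply/fsetP => t; rewrite !inE.
  rewrite N0 in sT sU.
  have -> : T = fset0 by apply/eqP; rewrite -fsubset0.
  by move=> _; apply/esym/eqP; rewrite -fsubset0.
by move=> /(congr1 set_of_comp); rewrite !comp_of_setK.
Qed.

Lemma mem_compositions n al : (al \in compositions n) = (weight al == n).
Proof.
apply/mapP/eqP => [[T _ ->]|<-]; first exact: weight_comp_of_set.
exists (set_of_comp al); last by rewrite set_of_compK.
rewrite fpowersetE; apply/fsubsetP => t.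
case: (eqVneq al [::]) => [->|al0]; first by case/imfsetP.
by rewrite !inE; case/imfsetP => j /= jP ->;
  have /(map_f (fun j => weight (take j al))) := jP;
  rewrite -/(psum al) -psum_filter // mem_filter => /andP[_].
Qed.

Lemma refinesP be al :
  reflect (exists2 bs : seq composition,
             flatten bs = be & map weight bs = map posnat_val al)
          (refines be al).
Proof.
rewrite /refines; elim: al be => [|a al IHal] be /=.
  rewrite inE; apply: (iffP eqP) => [->|[[|b bs] // <-]//]; by exists [::].
apply: (iffP allpairsP) => [[[b c] /= [bP /IHal[bs <- bsE] ->]]|[[|b bs] //]].
  by exists (b :: bs); rewrite //= bsE; move: bP; rewrite mem_compositions => /eqP->.
move=> /= <- [bE bsE]; exists (b, flatten bs); split => //=.
  by rewrite mem_compositions bE.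
by apply/IHal; exists bs.
Qed.

End CompositionTheory.

(* The linear map {malg G[K]} -> V with prescribed values on the basis K. *)
HB.lock Definition mlift (K : choiceType) (G : nzRingType) (V : lmodType G)
    (f : K -> V) (x : {malg G[K]}) : V :=
  \sum_(k <- msupp x) x@_k *: f k.
Canonical mlift_unlockable := Unlockable mlift.unlock.

Section Lift.
Context {K : choiceType} {G : nzRingType} {V : lmodType G}.

Lemma mliftE (f : K -> V) (x : {malg G[K]}) :
  mlift f x = \sum_(k <- msupp x) x@_k *: f k.
Proof. by rewrite unlock. Qed.

Lemma mliftEw (f : K -> V) (x : {malg G[K]}) (d : {fset K}) :
  msupp x `<=` d -> mlift f x = \sum_(k <- d) x@_k *: f k.
Proof.
move=> sd; rewrite unlock; apply: (big_fset_incl _ sd) => k _ /mcoeff_outdom ->.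
by rewrite scale0r.
Qed.

Fact mlift_is_linear (f : K -> V) : linear (mlift f).
Proof.
move=> a x y; set d := (msupp (a *: x + y) `|` msupp x) `|` msupp y.
have sd : msupp (a *: x + y) `|` msupp x `<=` d by exact: fsubsetUl.
rewrite !(@mliftEw f _ d) ?fsubsetUr //; last first.
- by apply: fsubset_trans sd; exact: fsubsetUl.
- by apply: fsubset_trans sd; exact: fsubsetUr.
rewrite scaler_sumr -big_split; apply: eq_bigr => k _ /=.
by rewrite mcoeffD mcoeffZ scalerDl scalerA.
Qed.
HB.instance Definition _ (f : K -> V) :=
  GRing.isLinear.Build G {malg G[K]} V *:%R (mlift f) (mlift_is_linear f).

Lemma mliftU (f : K -> V) k : mlift f << k >> = f k.
Proof.
by rewrite (mliftEw _ msuppU_le) big_seq_fset1 mcoeffUU scale1r.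
Qed.

Lemma eq_mlift (f g : K -> V) : f =1 g -> mlift f =1 mlift g.
Proof. by move=> fg x; rewrite unlock; apply: eq_bigr => k _; rewrite fg. Qed.

Lemma malg_linear_ext (f g : {malg G[K]} -> V) :
  linear f -> linear g -> (forall k, f << k >> = g << k >>) -> f =1 g.
Proof.
move=> lf lg fg x.
have h (u : {malg G[K]} -> V) : linear u -> u x = mlift (fun k => u << k >>) x.
  move=> lu; rewrite unlock; pose m := GRing.isLinear.Build G {malg G[K]} V *:%R u lu.
  pose U : {linear {malg G[K]} -> V} := HB.pack u m.
  rewrite {1}(monalgE x) -[u]/(U : _ -> _) raddf_sum; apply: eq_bigr => k _.
  rewrite -linearZ; congr (U _); apply/malgP => k'.
  by rewrite mcoeffZ !mcoeffU mulr_natr.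
by rewrite (h f) // (h g) //; apply: eq_mlift.
Qed.

End Lift.

Local Close Scope fset_scope.

Section QSym.
Variable R : comNzRingType.

(* [{poly R}] is R[q], with ['X] standing for q. *)
Definition QSym := {malg {poly R}[composition]}.
HB.instance Definition _ := GRing.Lmodule.on QSym.

Definition qM (al : composition) : QSym := << al >>.

Definition prepend (a : posnat) : QSym -> QSym :=
  mlift (fun ga => qM (a :: ga)).
HB.instance Definition _ a := GRing.Linear.on (prepend a).

Fixpoint qprod (al : composition) : composition -> QSym :=
  match al with
  | [::] => qM
  | a :: al' =>
    fix qprod_al (be : composition) : QSym :=
      match be with
      | [::] => qM (a :: al')
      | b :: be' => prepend a (qprod al' (b :: be'))
                    + prepend b (qprod_al be')
                    + 'X *: prepend (addp a b) (qprod al' be')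
      end
  end.

Definition qmul (x y : QSym) : QSym :=
  mlift (fun al => mlift (qprod al) y) x.

Local Notation "x ** y" := (qmul x y) (at level 40, left associativity).

Lemma prependM a al : prepend a (qM al) = qM (a :: al).
Proof. exact: mliftU. Qed.

Lemma qmulMM al be : qM al ** qM be = qprod al be.
Proof. by rewrite /qmul mliftU mliftU. Qed.

Fact qmul_linl y : linear (qmul^~ y).
Proof. by move=> c u v; rewrite /qmul linearP. Qed.

Fact qmul_linr x : linear (qmul x).
Proof.
move=> c u v; rewrite /qmul [LHS]mliftE [X in _ = _ *: X + _]mliftE.
rewrite [X in _ = _ + X]mliftE scaler_sumr -big_split.
apply: eq_bigr => k _ /=.
by rewrite linearP scalerDr !scalerA mulrC.
Qed.

Lemma qmul1 : left_id (qM [::]) qmul.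
Proof.
move=> x; rewrite /qmul mliftU.
apply: (malg_linear_ext (mlift_is_linear _) (g := id)) => // k.
by rewrite mliftU.
Qed.

Lemma qprod0 al : qprod al [::] = qM al.
Proof. by case: al. Qed.

Lemma qprod_cons a al b be :
  qprod (a :: al) (b :: be) = prepend a (qprod al (b :: be))
    + prepend b (qprod (a :: al) be) + 'X *: prepend (addp a b) (qprod al be).
Proof. by []. Qed.

Fact addpC : commutative addp.
Proof. by move=> a b; apply: val_inj; rewrite /= addnC. Qed.

Fact addpA : associative addp.
Proof. by move=> a b c; apply: val_inj; rewrite /= addnA. Qed.

Fact qprodC al be : qprod al be = qprod be al.
Proof.
elim: al be => [|a al IHal] be; first by rewrite qprod0.
elim: be => [|b be IHbe]; first by rewrite qprod0.
rewrite (qprod_cons a al b be) (qprod_cons b be a al).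
rewrite (IHal (b :: be)) (IHal be) IHbe (addpC b a).
by rewrite (addrC (prepend a _)).
Qed.

Fact qmulC : commutative qmul.
Proof.
move=> x; apply: (malg_linear_ext (qmul_linr x) (qmul_linl x)) => be.
move: x; apply: (malg_linear_ext (qmul_linl _) (qmul_linr _)) => al.
by rewrite !qmulMM qprodC.
Qed.

HB.instance Definition _ x :=
  GRing.isLinear.Build {poly R} QSym QSym *:%R (qmul x) (qmul_linr x).

Lemma qmulDl : left_distributive qmul +%R.
Proof. by move=> x y z; rewrite -!(qmulC z) linearD. Qed.

Lemma qmulZl c x y : (c *: x) ** y = c *: (x ** y).
Proof. by rewrite -!(qmulC y) linearZ. Qed.

(* The recursion for the product, with its two factors in general position. *)
Lemma qmul_prepend a b x y :
  prepend a x ** prepend b y = prepend a (x ** prepend b y)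
    + prepend b (prepend a x ** y) + 'X *: prepend (addp a b) (x ** y).
Proof.
have arr (c : {poly R}) (A A' B B' C C' : QSym) :
    (c *: A + A') + (c *: B + B') + 'X *: (c *: C + C') =
    c *: (A + B + 'X *: C) + (A' + B' + 'X *: C').
  by rewrite !scalerDr !scalerA ['X * c]mulrC (addrACA (c *: A)) [LHS]addrACA.
move: x; apply: malg_linear_ext => [c u v|c u v|al].
- by rewrite linearP qmulDl qmulZl.
- by rewrite /= -arr !(linearP, qmulDl, qmulZl) /=.
move: y; apply: malg_linear_ext => [c u v|c u v|be].
- by rewrite !linearP.
- by rewrite /= -arr !linearP.
by rewrite -/(qM al) -/(qM be) !prependM !qmulMM qprod_cons.
Qed.

Fact qmul3_prepend a b c x y z :
  let ax := prepend a x in let yb := prepend b y in let cz := prepend c z in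
  ax ** yb ** cz = prepend a (x ** yb ** cz)
    + prepend b (ax ** y ** cz) + prepend c (ax ** yb ** z)
    + 'X *: (prepend (addp a b) (x ** y ** cz)
             + prepend (addp a c) (x ** yb ** z)
             + prepend (addp b c) (ax ** y ** z))
    + 'X *: ('X *: prepend (addp (addp a b) c) (x ** y ** z)).
Proof.
move=> ax yb cz.
have arr (p : {poly R}) (a1 c1 ac b2 c2 bc ab c3 abc : QSym) :
    (a1 + c1 + p *: ac) + (b2 + c2 + p *: bc) + p *: (ab + c3 + p *: abc) =
    a1 + b2 + (c1 + c2 + p *: c3) + p *: (ab + ac + bc) + p *: (p *: abc).
  by rewrite !scalerDr [LHS](AC (3*3*3) ((1*4)*(2*5*8)*(7*3*6)*9)).
have zE : prepend c (ax ** yb ** z) = prepend c (prepend a (x ** yb) ** z)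
    + prepend c (prepend b (ax ** y) ** z)
    + 'X *: prepend c (prepend (addp a b) (x ** y) ** z).
  by rewrite [ax ** yb]qmul_prepend 2!qmulDl qmulZl !linearD linearZ.
rewrite zE [ax ** yb]qmul_prepend -/ax -/yb 2!qmulDl qmulZl.
rewrite (qmul_prepend a c (x ** yb) z) (qmul_prepend b c (ax ** y) z).
rewrite (qmul_prepend (addp a b) c (x ** y) z) -/cz.
exact: arr.
Qed.

Fact qmul_cycle x y z : x ** y ** z = y ** z ** x.
Proof.
have cyc3 (u v w : QSym) : u + v + w = v + w + u.
  by rewrite [RHS]addrC addrA.
have basis al be ga : qM al ** qM be ** qM ga = qM be ** qM ga ** qM al.
  have [m] := ubnP (size al + size be + size ga).
  elim: m al be ga => // m IHm [|a al] be ga.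
    by move=> _; rewrite (qmul1 (qM be)) (qmulC _ (qM [::])) qmul1.
  case: be => [|b be].
    by move=> _; rewrite (qmulC _ (qM [::])) 2!qmul1; exact: qmulC.
  case: ga => [|c ga] lem.
    rewrite (qmulC _ (qM [::])) (qmulC (qM (b :: be)) (qM [::])) 2!qmul1.
    exact: qmulC.
  have IH u v w : (size u + size v + size w < m)%N ->
      qM u ** qM v ** qM w = qM v ** qM w ** qM u by exact: IHm.
  rewrite -(prependM a al) -(prependM b be) -(prependM c ga).
  rewrite (qmul3_prepend a b c) (qmul3_prepend b c a).
  rewrite (prependM a al) (prependM b be) (prependM c ga).
  rewrite (IH al (b :: be) (c :: ga)); last by rewrite /= in lem *; lia.
  rewrite (IH (a :: al) be (c :: ga)); last by rewrite /= in lem *; lia.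
  rewrite (IH (a :: al) (b :: be) ga); last by rewrite /= in lem *; lia.
  rewrite (IH al be (c :: ga)); last by rewrite /= in lem *; lia.
  rewrite (IH al (b :: be) ga); last by rewrite /= in lem *; lia.
  rewrite (IH (a :: al) be ga); last by rewrite /= in lem *; lia.
  rewrite (IH al be ga); last by rewrite /= in lem *; lia.
  rewrite -(addpA a b c) (addpC a (addp b c)) (addpC a b) (addpC a c).
  by rewrite (cyc3 (prepend a _)) -(cyc3 (prepend (addp b c) _)).
move: x; apply: malg_linear_ext => [e u v|e u v|al].
- by rewrite !(qmulDl, qmulZl).
- exact: qmul_linr.
move: y; apply: malg_linear_ext => [e u v|e u v|be].
- by rewrite (qmul_linr (qM al)) !(qmulDl, qmulZl).
- by rewrite !(qmulDl, qmulZl).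
move: z; apply: malg_linear_ext => [e u v|e u v|ga].
- exact: qmul_linr.
- by rewrite (qmul_linr (qM be)) !(qmulDl, qmulZl).
exact: basis.
Qed.

Fact qmulA : associative qmul.
Proof. by move=> x y z; rewrite qmulC -qmul_cycle. Qed.

Fact qM0_neq0 : qM [::] != 0.
Proof. by rewrite monalgU_eq0 oner_neq0. Qed.

HB.instance Definition _ := GRing.Zmodule_isComNzRing.Build QSym
  qmulA qmulC qmul1 qmulDl qM0_neq0.
HB.instance Definition _ := GRing.Lmodule_isLalgebra.Build {poly R} QSym
  (fun c x y => esym (qmulZl c x y)).
HB.instance Definition _ := GRing.Lalgebra_isComAlgebra.Build {poly R} QSym.

End QSym.

Arguments qM {R} al.

Section Hopf.
Variable R : comNzRingType.
Local Notation Q := (QSym R).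

(* QSym_q (x) QSym_q, the free module on the tensors of basis elements. *)
Definition QSym2 := {malg {poly R}[(composition * composition)%type]}.
HB.instance Definition _ := GRing.Lmodule.on QSym2.

Definition tensor (x y : Q) : QSym2 :=
  mlift (fun al => mlift (fun be => (<< (al, be) >> : QSym2)) y) x.

Definition tensor_map (f g : Q -> Q) : QSym2 -> QSym2 :=
  mlift (fun p => tensor (f (qM p.1)) (g (qM p.2))).

Definition mul2 : QSym2 -> Q := mlift (fun p => qM p.1 * qM p.2).

Definition counit (x : Q) : {poly R} := x@_([::] : composition).

Definition coproduct : Q -> QSym2 :=
  mlift (fun al : composition =>
    \sum_(k < (size al).+1) tensor (qM (take k al)) (qM (drop k al))).

Definition convolution (f g : Q -> Q) (x : Q) : Q :=
  mul2 (tensor_map f g (coproduct x)).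

Definition is_antipode (S : {linear Q -> Q}) : Prop :=
  forall x : Q, convolution S id x = counit x *: 1
             /\ convolution id S x = counit x *: 1.

Definition qF (al : composition) : Q :=
  \sum_(be <- compositions (weight al) | refines be al)
    'X ^+ (weight al - size be) *: qM be.

Definition qE (al : composition) : Q :=
  \sum_(be <- compositions (weight al) | refines al be)
    'X ^+ (size al - size be) *: qM be.

Lemma qM_nil : qM [::] = 1 :> Q.
Proof. by []. Qed.

Lemma qM_mul (a b : posnat) (al be : composition) :
  qM (a :: al) * qM (b :: be) =
    prepend a (qM al * qM (b :: be)) + prepend b (qM (a :: al) * qM be)
    + 'X *: prepend (addp a b) (qM al * qM be) :> Q.
Proof. by rewrite -!prependM; exact: qmul_prepend. Qed.

Lemma counitM (al : composition) : counit (qM al) = (al == [::])%:R.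
Proof. exact: mcoeffU. Qed.

Lemma coproductM (al : composition) :
  coproduct (qM al) =
  \sum_(k < (size al).+1) tensor (qM (take k al)) (qM (drop k al)).
Proof. exact: mliftU. Qed.

Lemma tensorM (al be : composition) : tensor (qM al) (qM be) = << (al, be) >>.
Proof. by rewrite /tensor !mliftU. Qed.

Fact mul2_tensor x y : mul2 (tensor x y) = x * y.
Proof.
move: x; apply: malg_linear_ext => [c u v|c u v|al].
- by rewrite /tensor /mul2 !linearP.
- by rewrite mulrDl scalerAl.
move: y; apply: malg_linear_ext => [c u v|c u v|be].
- by rewrite /tensor /mul2 !mliftU !linearP.
- by rewrite mulrDr scalerAr.
by rewrite -/(qM al) -/(qM be) tensorM /mul2 mliftU.
Qed.

Lemma convolutionM (f g : Q -> Q) (al : composition) :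
  convolution f g (qM al) =
  \sum_(k < (size al).+1) f (qM (take k al)) * g (qM (drop k al)).
Proof.
rewrite /convolution coproductM /tensor_map linear_sum /mul2 linear_sum.
by apply: eq_bigr => k _ /=; rewrite tensorM mliftU; exact: mul2_tensor.
Qed.

Fact convolution_is_linear f g : linear (convolution f g).
Proof. by move=> c x y; rewrite /convolution /mul2 /tensor_map /coproduct !linearP. Qed.

Let cv (f g : composition -> Q) al : Q :=
  \sum_(k < (size al).+1) f (take k al) * g (drop k al).

Let cv_cons f g a al :
  cv f g (a :: al) = f [::] * g (a :: al) + cv (fun u => f (a :: u)) g al.
Proof. by rewrite /cv big_ord_recl. Qed.

Let cv_nil f g : cv f g [::] = f [::] * g [::].
Proof. exact: big_ord1. Qed.

Let cvA f g h al : cv (cv f g) h al = cv f (cv g h) al.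
Proof.
elim: al f => [|a al IHal] f; first by rewrite !cv_nil mulrA.
rewrite [LHS]cv_cons [RHS]cv_cons -IHal cv_nil (cv_cons g) mulrDr mulrA -addrA.
congr (_ + _); rewrite /cv mulr_sumr -big_split; apply: eq_bigr => k _.
by rewrite -/(cv f g (a :: take k al)) cv_cons mulrDl mulrA.
Qed.

Let eps (al : composition) : Q := (al == [::])%:R.

Let cv1 f al : cv f eps al = f al.
Proof.
rewrite /cv big_ord_recr /= take_size drop_size /eps eqxx mulr1 big1 ?add0r //.
by move=> k _; rewrite -size_eq0 size_drop subn_eq0 leqNgt ltn_ord mulr0.
Qed.

Let cv1l f al : cv eps f al = f al.
Proof.
rewrite /cv big_ord_recl /= take0 drop0 /eps eqxx mul1r big1 ?addr0 //.
by case: al => [|a al] [k kl] _ //=; rewrite mul0r.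
Qed.

Let Fixpoint SLf (m : nat) (al : composition) : Q :=
  match m, al with
  | m'.+1, _ :: _ => - \sum_(k < size al) SLf m' (take k al) * qM (drop k al)
  | _, _ => 1
  end.

Let Fixpoint SRf (m : nat) (al : composition) : Q :=
  match m, al with
  | m'.+1, _ :: _ =>
    - \sum_(k < size al) qM (take k.+1 al) * SRf m' (drop k.+1 al)
  | _, _ => 1
  end.

Let SL al := SLf (size al) al.
Let SR al := SRf (size al) al.

Let SLfE m al : (size al <= m)%N -> SLf m al = SL al.
Proof.
suff h n : (size al <= m)%N -> (size al <= n)%N -> SLf m al = SLf n al.
  by move=> am; apply: h.
elim: m n al => [|m IHm] [|n] [|a al] //= am an; congr (- _).
apply: eq_bigr => k _; congr (_ * _).
have sk : (size (take k (a :: al)) <= size al)%N.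
  by rewrite size_take; have := ltn_ord k; rewrite /=; case: ltnP => /=; lia.
by apply: IHm; apply: leq_trans sk _.
Qed.

Let SRfE m al : (size al <= m)%N -> SRf m al = SR al.
Proof.
suff h n : (size al <= m)%N -> (size al <= n)%N -> SRf m al = SRf n al.
  by move=> am; apply: h.
elim: m n al => [|m IHm] [|n] [|a al] //= am an; congr (- _).
apply: eq_bigr => k _; congr (_ * _).
have sk : (size (drop k al) <= size al)%N by rewrite size_drop leq_subr.
by apply: IHm; apply: leq_trans sk _.
Qed.

Let SL_inv al : cv SL qM al = eps al.
Proof.
case: al => [|a al]; first by rewrite /cv big_ord1 /= mulr1.
rewrite /cv big_ord_recr /= take_size drop_size mulr1 /eps /=.
rewrite {2}/SL /=; apply/eqP; rewrite subr_eq0; apply/eqP.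
apply: eq_bigr => k _; rewrite SLfE // size_take.
by have := ltn_ord k; rewrite /=; case: ltnP => /=; lia.
Qed.

Let SR_inv al : cv qM SR al = eps al.
Proof.
case: al => [|a al]; first by rewrite /cv big_ord1 /= mulr1.
rewrite /cv big_ord_recl /= mul1r /eps /=.
rewrite {1}/SR /=; apply/eqP; rewrite addrC subr_eq0; apply/eqP.
by apply: eq_bigr => k _; rewrite SRfE // size_drop leq_subr.
Qed.

Let SL_SR al : SL al = SR al.
Proof.
rewrite -[LHS]cv1 -[RHS]cv1l.
have -> : cv SL eps al = cv SL (cv qM SR) al.
  by apply: eq_bigr => k _; rewrite SR_inv.
by rewrite -cvA; apply: eq_bigr => k _; rewrite SL_inv.
Qed.

Lemma antipode_exists : exists S : {linear Q -> Q}, is_antipode S.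
Proof.
exists (mlift SL : {linear Q -> Q}).
have lc : linear (fun x : Q => counit x *: (1 : Q)).
  by move=> c x y; rewrite /counit mcoeffD mcoeffZ scalerDl scalerA.
move=> x; split; move: x;
  apply: (malg_linear_ext (convolution_is_linear _ _) lc) => al.
- rewrite -/(qM al) convolutionM counitM scaler_nat.
  by rewrite -[RHS]/(eps al) -SL_inv; apply: eq_bigr => k _;
  congr (_ * _); exact: mliftU.
- rewrite -/(qM al) convolutionM counitM scaler_nat.
  rewrite -[RHS]/(eps al) -SR_inv; apply: eq_bigr => k _.
  by rewrite -SL_SR; congr (_ * _); exact: mliftU.
Qed.

End Hopf.

(* Main.v *)
(** Write [attach a] for the operator [prepend a + q merge a], where [merge a]
    adds [a] to the first entry.  Then [E_(a :: al) = attach a E_al], and since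
    [x * prepend c y = headmul (attach c x) y + headmul x (prepend c y)], where
    [headmul] keeps the terms of a product whose first entry comes from the left
    factor alone, the sum of [(-1)^k E_(rev (take k al)) * M_(drop k al)] over
    [k] telescopes to 0.  This is the recursion that determines [S (M_al)].

    For [F], let [T] be [S] followed by reversal, so that
    [T (M_al) = (-1)^l(al) E_al].  Up to sign, [T] exchanges [prepend 1] and
    [attach 1] on elements without constant term, while
    [F_(1 :: al) = prepend 1 F_al] and
    [F_(1 + a :: al) = attach 1 F_(a :: al)]; complementing the set of partial
    sums exchanges these two ways of adding a cell in front. *)

From HB Require Import structures.
Require Import Defs.
From mathcomp Require Import all_boot all_order all_algebra.
From mathcomp Require Import finmap zify.
Import GRing.Theory.
Local Open Scope ring_scope.

(** * Comparison of positive integers by addition *)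

Lemma posnat_gt0 (a : posnat) : (0 < a)%N.
Proof. by case: a. Qed.

Definition pos1 : posnat := @PosNat 1 isT.

Lemma addp_neq (a b : posnat) : (addp a b == a) = false.
Proof. by rewrite -val_eqE /=; have := posnat_gt0 b; lia. Qed.

Lemma addpI (a : posnat) : injective (addp a).
Proof. by move=> b c /(congr1 val)/addnI/val_inj. Qed.

(** Trichotomy phrased by [addp], so that a case analysis on first entries yields exactly the shapes
    in the lemmas on [refines], without subtraction. *)
Variant posnat_cmp_spec (a : posnat) : posnat -> Prop :=
| PosnatEq : posnat_cmp_spec a a
| PosnatGt c : posnat_cmp_spec a (addp a c)
| PosnatLt b c of a = addp b c : posnat_cmp_spec a b.

Lemma posnat_cmpP (a b : posnat) : posnat_cmp_spec a b.
Proof.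
have [ab|ba|/val_inj->] := ltngtP a b; last exact: PosnatEq.
  have c0 : (0 < b - a)%N by rewrite subn_gt0.
  suff -> : b = addp a (PosNat c0) by exact: PosnatGt.
  by apply: val_inj; rewrite /= subnKC // ltnW.
have c0 : (0 < a - b)%N by rewrite subn_gt0.
apply: (@PosnatLt _ _ (PosNat c0)).
by apply: val_inj; rewrite /= subnKC // ltnW.
Qed.

Variant posnat_spec : posnat -> Prop :=
| PosnatOne : posnat_spec pos1
| PosnatSucc b : posnat_spec (addp pos1 b).

Lemma posnatP a : posnat_spec a.
Proof.
case: (posnat_cmpP pos1 a) => [|c|b c /(congr1 val) /=]; try by constructor.
by have := posnat_gt0 b; have := posnat_gt0 c; lia.
Qed.

Lemma weight_rev al : weight (rev al) = weight al.
Proof. by rewrite /weight map_rev sumn_rev. Qed.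

(** * Refinement *)

Section Refinement.
Implicit Types (al be : composition).

Lemma refines_consP be (a : posnat) al :
  reflect (exists d e, [/\ be = d ++ e, weight d = a & refines e al])
          (refines be (a :: al)).
Proof.
apply: (iffP allpairsP) => [[[d e] /= []]|[d [e [-> da eal]]]].
  by rewrite mem_compositions => /eqP da eal ->; exists d, e.
by exists (d, e); rewrite /= mem_compositions da.
Qed.

Lemma refines_nilr be : refines be [::] = (be == [::]).
Proof. by rewrite /refines inE. Qed.

Lemma refines_nill al : refines [::] al = (al == [::]).
Proof.
case: al => [|a al]; first by rewrite refines_nilr.
apply/refines_consP => -[[|d0 d] [e [//= _ a0 _]]].
by have := posnat_gt0 a; rewrite -a0.
Qed.

(** The first block of a refinement is a non-empty prefix. Comparing its first entry with that of
    the coarser composition leaves three cases, settled here and in the next two lemmas. *)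
Lemma refines_cons_same a be al : refines (a :: be) (a :: al) = refines be al.
Proof.
apply/refines_consP/idP => [[[|d0 d] [e [/=]]]|beal].
- by move=> _ a0; have := posnat_gt0 a; rewrite -a0.
- case=> <- -> /eqP; rewrite weight_cons -[X in _ == X]addn0 eqn_add2l weight_eq0.
  by move/eqP->.
- by exists [:: a], be; rewrite weight_cons addn0.
Qed.

Lemma refines_cons_addp b c be al :
  refines (b :: be) (addp b c :: al) = refines be (c :: al).
Proof.
apply/refines_consP/refines_consP => [[[|d0 d] [e [/=]]]|[d [e [-> dc eal]]]].
- by move=> _ bc0; have := posnat_gt0 (addp b c); rewrite /= -bc0.
- by case=> <- -> /addnI dc eal; exists d, e.
- by exists (b :: d), e; rewrite weight_cons dc.
Qed.

Lemma refines_addp_cons b c be al : refines (addp b c :: be) (b :: al) = false.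
Proof.
apply/refines_consP => -[[|d0 d] [e [/=]]].
  by move=> _ b0; have := posnat_gt0 b; rewrite -b0.
case=> <- _; rewrite weight_cons /= => h _.
by have := posnat_gt0 c; lia.
Qed.

Lemma refines_weight be al : refines be al -> weight be = weight al.
Proof.
elim: al be => [|a al IHal] be; first by rewrite refines_nilr => /eqP->.
by case/refines_consP => d [e [-> da /IHal eal]]; rewrite weight_cat da eal.
Qed.

Lemma refines_size be al : refines be al -> (size al <= size be)%N.
Proof.
elim: al be => [|a al IHal] be //.
case/refines_consP => -[|d0 d] [e [-> da /IHal eal]] /=.
  by have := posnat_gt0 a; rewrite -da.
by rewrite size_cat; lia.
Qed.

Lemma size_weight al : (size al <= weight al)%N.
Proof.
elim: al => //= a al IHal.
by rewrite weight_cons; have := posnat_gt0 a; lia.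
Qed.

Lemma refines_rev be al : refines (rev be) (rev al) = refines be al.
Proof.
wlog suff: be al / refines be al -> refines (rev be) (rev al).
  by move=> h; apply/idP/idP => /h; rewrite ?revK.
(* Reverse the order of the blocks and also each block. *)
case/refinesP => bs <- bsE; apply/refinesP; exists (rev (map rev bs)).
  by rewrite rev_flatten.
rewrite !map_rev -bsE -map_comp; congr rev; apply: eq_map => b /=.
exact: weight_rev.
Qed.

End Refinement.

(** * Partial sums, transpose and complement *)

Section Cuts.
Implicit Types (al be : composition).
Local Open Scope fset_scope.

Lemma set_of_compP t al :
  reflect (exists be ga, [/\ al = be ++ ga, be != [::], ga != [::]
             & weight be = t])
          (t \in set_of_comp al).
Proof.
apply: (iffP (imfsetP _ _ _ _)) => [[j /=]|[be [ga [-> be0 ga0 <-]]]].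
  rewrite mem_iota => jP ->; exists (take j al), (drop j al).
  rewrite cat_take_drop -!size_eq0 -!lt0n size_take size_drop.
  have /andP[j0 js] : (0 < j < size al)%N by lia.
  by rewrite js subn_gt0.
exists (size be); last by rewrite take_size_cat.
case: be be0 => // b be _; case: ga ga0 => // c ga _.
by rewrite /= mem_iota size_cat /= addnS add1n !ltnS leq_addr.
Qed.

Lemma set_of_comp_Nset al : set_of_comp al `<=` Nset (weight al).
Proof.
apply/fsubsetP => t /set_of_compP[be [ga [-> be0 ga0 <-]]].
rewrite mem_Nset weight_cat; move: be0 ga0; rewrite -!weight_eq0 -!lt0n; lia.
Qed.

(** Reduces identities between compositions of equal weight to a comparison of cuts. *)
Lemma set_of_comp_inj al be : weight al = weight be ->
  set_of_comp al =i set_of_comp be -> al = be.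
Proof.
by move=> w /fsetP s; rewrite -(set_of_compK al) w s set_of_compK.
Qed.

Lemma set_of_comp_cons t a al : (t \in set_of_comp (a :: al)) =
  (al != [::]) && ((t == a :> nat) || (a < t)%N && ((t - a)%N \in set_of_comp al)).
Proof.
apply/set_of_compP/idP => [[[|b be] [ga [//]]]|].
  case=> <- -> _ ga0 <-; rewrite weight_cons.
  case: (eqVneq be [::]) => [->|be0]; first by rewrite /= addn0 eqxx ga0.
  apply/andP; split; first by case: be be0.
  apply/orP; right; apply/andP; split.
    by move: be0; rewrite -weight_eq0 -lt0n; lia.
  by rewrite addKn; apply/set_of_compP; exists be, ga.
case/andP=> al0 /orP[/eqP->|/andP[a_t /set_of_compP[be [ga [-> be0 ga0 bE]]]]].
  by exists [:: a], al; rewrite weight_cons addn0.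
by exists (a :: be), ga; rewrite weight_cons bE subnKC // ltnW.
Qed.

Lemma set_of_comp_rev t al : (t <= weight al)%N ->
  (t \in set_of_comp (rev al)) = ((weight al - t)%N \in set_of_comp al).
Proof.
move=> ta; apply/set_of_compP/set_of_compP => -[be [ga [E be0 ga0 bE]]].
  exists (rev ga), (rev be); rewrite -rev_cat -E revK weight_rev.
  rewrite -!size_eq0 !size_rev !size_eq0; split=> //.
  by rewrite -(weight_rev al) E weight_cat -bE addKn.
exists (rev ga), (rev be); rewrite -rev_cat -E weight_rev.
rewrite -!size_eq0 !size_rev !size_eq0; split=> //.
by move: ta bE; rewrite E weight_cat; lia.
Qed.

(* The transpose without its reversal, which (see [complement1] and
   [complementS]) is compatible with adding cells at the front. *)
Definition complement al : composition :=
  comp_of_set (weight al) (Nset (weight al) `\` set_of_comp al).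

Lemma weight_complement al : weight (complement al) = weight al.
Proof. exact: weight_comp_of_set. Qed.

Lemma complement_eq0 al : (complement al == [::]) = (al == [::]).
Proof. by rewrite -!weight_eq0 weight_complement. Qed.

Lemma mem_complement t al : (t \in set_of_comp (complement al)) =
  (0 < t < weight al)%N && (t \notin set_of_comp al).
Proof.
case: (eqVneq al [::]) => [->|al0].
  rewrite /complement comp0 [weight _]/= ltn0 andbF.
  apply/negbTE/set_of_compP => -[be [ga [E be0 _ _]]].
  by case: be be0 E.
rewrite comp_of_setK ?fsubsetDl //; last by rewrite lt0n weight_eq0.
by rewrite inE mem_Nset andbC.
Qed.

(** Reversing a composition of [n] moves each cut [t] to [n - t], which is the reflection built into
    the transpose. *)
Lemma transposeE al : transpose al = rev (complement al).
Proof.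
case: (eqVneq al [::]) => [->|al0]; first by rewrite /transpose /complement !comp0.
have w0 : (0 < weight al)%N by rewrite lt0n weight_eq0.
apply: set_of_comp_inj => [|t].
  by rewrite weight_comp_of_set weight_rev weight_complement.
have [tw|wt] := ltnP (weight al) t.
  transitivity false; last apply/esym; apply/negbTE/negP.
    move/(fsubsetP (set_of_comp_Nset _)).
    by rewrite mem_Nset weight_comp_of_set; lia.
  move/(fsubsetP (set_of_comp_Nset _)).
  by rewrite mem_Nset weight_rev weight_complement; lia.
rewrite set_of_comp_rev weight_complement // mem_complement.
rewrite comp_of_setK //; last first.
  apply/fsubsetP => u /imfsetP[s /=]; rewrite inE !mem_Nset => /andP[_ sP] ->.
  by lia.
apply/imfsetP/andP => [[s /=]|[sP sN]].
  rewrite inE mem_Nset => /andP[sN sP] ->.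
  by rewrite subKn; [split=> //; lia | lia].
exists (weight al - t)%N; last by rewrite subKn.
by rewrite /= inE mem_Nset sN sP.
Qed.

(** A leading 1 makes 1 a cut, so 1 is no cut of the complement and the new cell joins its first
    block. The hypothesis names that block and forces [al] to be non-empty. *)
Lemma complement1 b al be : complement al = b :: be ->
  complement (pos1 :: al) = addp pos1 b :: be.
Proof.
move=> cE; have w := weight_complement al.
have al0 : al != [::] by rewrite -complement_eq0 cE.
apply: set_of_comp_inj => [|t].
  by rewrite weight_complement !weight_cons /= -w cE weight_cons addnA.
have := mem_complement (t - 1)%N al; rewrite cE mem_complement !set_of_comp_cons.
rewrite weight_cons al0 /=.
by case: t => [|[|t]] /=; rewrite ?andbF ?subn1 ?add1n ?eqSS ?ltnS ?subSS /= ?andbF.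
Qed.

(** A first entry above 1 leaves 1 uncut, so the complement starts with a block of size 1. *)
Lemma complementS a al :
  complement (addp pos1 a :: al) = pos1 :: complement (a :: al).
Proof.
apply: set_of_comp_inj => [|t].
  by rewrite weight_complement !weight_cons weight_complement weight_cons addnA.
rewrite mem_complement !set_of_comp_cons mem_complement complement_eq0.
rewrite set_of_comp_cons !weight_cons /=.
have := posnat_gt0 a.
case: t => [|[|t]] //=; rewrite ?subn1 /=; lia.
Qed.

End Cuts.

(** * Coefficients of linear extensions *)

Section MliftCoef.
Context {K : choiceType} {G : nzRingType} {L : choiceType}.

Lemma coef_mlift (f : K -> {malg G[L]}) (x : {malg G[K]}) k :
  (mlift f x)@_k = \sum_(j <- msupp x) x@_j * (f j)@_k.
Proof. by rewrite mliftE raddf_sum; apply: eq_bigr => j _; exact: mcoeffZ. Qed.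

Lemma mlift_coef (f : K -> {malg G[L]}) (x : {malg G[K]}) i k :
  (forall j, (f j)@_k = (j == i)%:R) -> (mlift f x)@_k = x@_i.
Proof.
move=> fk; rewrite coef_mlift; under eq_bigr => j _ do rewrite fk.
have [ix|/mcoeff_outdom x0] := boolP (i \in msupp x); last first.
  rewrite x0 big1_seq // => j /andP[_ jx].
  by case: eqVneq => [ji|]; rewrite ?mulr0 // ji x0 mul0r.
rewrite (bigD1_seq i) ?fset_uniq //= eqxx mulr1 big1 ?addr0 // => j /negbTE ->.
by rewrite mulr0.
Qed.

Lemma mlift_coef0 (f : K -> {malg G[L]}) (x : {malg G[K]}) k :
  (forall j, (f j)@_k = 0) -> (mlift f x)@_k = 0.
Proof.
by move=> fk; rewrite coef_mlift big1 // => j _; rewrite fk mulr0.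
Qed.

End MliftCoef.

(** * Operators on [QSym] and the antipode *)

Section Operators.
Variable R : comNzRingType.
Local Notation Q := (QSym R).
Implicit Types (a b c : posnat) (al be : composition) (x y : Q).

Lemma coef_qM al be : (qM al : Q)@_be = (al == be)%:R.
Proof. exact: mcoeffU. Qed.

Lemma coef_prepend_nil a x : (prepend a x)@_[::] = 0.
Proof. by apply: mlift_coef0 => j; rewrite coef_qM. Qed.

Lemma coef_prepend a x be : (prepend a x)@_(a :: be) = x@_be.
Proof. by apply: mlift_coef => j; rewrite coef_qM eqseq_cons eqxx. Qed.

Lemma coef_prepend_neq a b x be : a != b -> (prepend a x)@_(b :: be) = 0.
Proof.
by move=> /negbTE ab; apply: mlift_coef0 => j; rewrite coef_qM eqseq_cons ab.
Qed.

Definition merge (a : posnat) : Q -> Q :=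
  mlift (fun ga => if ga is b :: ga' then qM (addp a b :: ga') else 0).
HB.instance Definition _ a := GRing.Linear.on (merge a).

Lemma merge_nil a : merge a (qM [::]) = 0.
Proof. exact: mliftU. Qed.

Lemma merge_cons a b al : merge a (qM (b :: al)) = qM (addp a b :: al).
Proof. exact: mliftU. Qed.

Lemma coef_merge_nil a x : (merge a x)@_[::] = 0.
Proof. by apply: mlift_coef0 => -[|b j]; rewrite ?mcoeff0 // coef_qM. Qed.

Lemma coef_merge a b x be : (merge a x)@_(addp a b :: be) = x@_(b :: be).
Proof.
apply: mlift_coef => -[|c j]; first by rewrite mcoeff0.
by rewrite coef_qM !eqseq_cons (inj_eq (@addpI a)).
Qed.

Lemma coef_merge_le a b x be : (b <= a)%N -> (merge a x)@_(b :: be) = 0.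
Proof.
move=> ba; apply: mlift_coef0 => -[|c j]; first by rewrite mcoeff0.
rewrite coef_qM eqseq_cons -val_eqE /=; case: eqP => //.
by have := posnat_gt0 c; lia.
Qed.

Definition attach (a : posnat) (x : Q) : Q := prepend a x + 'X *: merge a x.

Fact attach_is_linear a : linear (attach a).
Proof.
by move=> c x y; rewrite /attach !linearP !scalerDr !scalerA addrACA.
Qed.
HB.instance Definition _ a :=
  GRing.isLinear.Build {poly R} Q Q *:%R (attach a) (attach_is_linear a).

Lemma merge_prepend a b x : merge a (prepend b x) = prepend (addp a b) x.
Proof.
move: x; apply: malg_linear_ext => [c x y|c x y|al]; rewrite ?linearP //.
by rewrite -/(qM al) !prependM merge_cons.
Qed.

Lemma merge_merge a b x : merge a (merge b x) = merge (addp a b) x.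
Proof.
move: x; apply: malg_linear_ext => [c x y|c x y|[|d al]]; rewrite ?linearP //.
  by rewrite -/(qM [::]) !merge_nil linear0.
by rewrite -/(qM (d :: al)) !merge_cons addpA.
Qed.

(** With [qE_cons] this makes [merge a] send the [qE] of [b :: al] to that of [addp a b :: al], as
    [T_merge] requires. *)
Lemma merge_attach a b x : merge a (attach b x) = attach (addp a b) x.
Proof. by rewrite linearD linearZ /= merge_prepend merge_merge. Qed.

(** * Coefficients of [qF] and [qE], and their recursions at the front *)

Lemma coef_sum_qM (s : seq composition) (P : pred composition)
    (c : composition -> {poly R}) be : uniq s ->
  (\sum_(ga <- s | P ga) c ga *: (qM ga : Q))@_be =
  if (be \in s) && P be then c be else 0.
Proof.
move=> us; rewrite raddf_sum /=.
under eq_bigr => ga _ do rewrite mcoeffZ coef_qM.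
case: ifP => [/andP[bs Pb]|bsP].
  rewrite -big_filter (bigD1_seq be) ?filter_uniq ?mem_filter ?Pb //=.
  by rewrite eqxx mulr1 big1 ?addr0 // => ga /negbTE->; rewrite mulr0.
rewrite big1_seq // => ga /andP[Pg gs]; case: eqVneq => [gb|]; rewrite ?mulr0 //.
by rewrite -gb Pg gs in bsP.
Qed.

Lemma coef_qF al be : (qF R al)@_be =
  if refines be al then 'X^(weight al - size be) else 0.
Proof.
rewrite coef_sum_qM ?uniq_compositions // mem_compositions.
by case: (boolP (refines _ _)) => [/refines_weight->|_]; rewrite ?eqxx ?andbF.
Qed.

Lemma coef_qE al be : (qE R al)@_be =
  if refines al be then 'X^(size al - size be) else 0.
Proof.
rewrite coef_sum_qM ?uniq_compositions // mem_compositions.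
by case: (boolP (refines _ _)) => [/refines_weight->|_]; rewrite ?eqxx ?andbF.
Qed.

Lemma qF_nil : qF R [::] = 1.
Proof.
apply/malgP => be; rewrite coef_qF refines_nilr coef_qM eq_sym.
by case: eqVneq => // <-.
Qed.

Lemma qE_nil : qE R [::] = 1.
Proof.
by apply/malgP => be; rewrite coef_qE refines_nill coef_qM eq_sym; case: eqP.
Qed.

(** In a coarsening of [a :: al] either [a] stays alone or it is absorbed into the next block;
    absorption lowers the length by one and costs a factor ['X]. *)
Lemma qE_cons a al : qE R (a :: al) = attach a (qE R al).
Proof.
apply/malgP => -[|b be]; rewrite coef_qE mcoeffD mcoeffZ.
  by rewrite refines_nilr coef_prepend_nil coef_merge_nil mulr0 addr0.
case: (posnat_cmpP a b) => [|c|{}b c ->].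
- rewrite refines_cons_same coef_prepend coef_merge_le // mulr0 addr0 coef_qE.
  by rewrite subSS.
- rewrite refines_cons_addp coef_merge coef_prepend_neq; last first.
    by rewrite eq_sym addp_neq.
  (* Refinement gives [size be < size al], so the truncated exponents differ by exactly one. *)
  rewrite add0r coef_qE; case: ifP => [/refines_size|]; rewrite ?mulr0 //=.
  by move=> h; rewrite -exprS -subSn.
rewrite refines_addp_cons coef_prepend_neq ?addp_neq //.
by rewrite coef_merge_le ?mulr0 ?addr0 //= leq_addr.
Qed.

Lemma qF_cons1 al : qF R (pos1 :: al) = prepend pos1 (qF R al).
Proof.
apply/malgP => -[|b be]; rewrite coef_qF.
  by rewrite refines_nill coef_prepend_nil.
case: (posnatP b) => [|{}b].
  by rewrite refines_cons_same coef_prepend weight_cons coef_qF subSS.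
by rewrite refines_addp_cons coef_prepend_neq // eq_sym addp_neq.
Qed.

(** A refinement of [addp pos1 a :: al] starts with 1, or arises from one of [a :: al] by adding 1
    to its first entry; the latter raises weight minus length by one, hence the factor ['X]. *)
Lemma qF_consS a al :
  qF R (addp pos1 a :: al) = attach pos1 (qF R (a :: al)).
Proof.
apply/malgP => -[|b be]; rewrite coef_qF mcoeffD mcoeffZ.
  by rewrite refines_nill coef_prepend_nil coef_merge_nil mulr0 addr0.
case: (posnatP b) => [|{}b].
  rewrite refines_cons_addp coef_prepend coef_merge_le // mulr0 addr0 coef_qF.
  by rewrite !weight_cons /= -addnA subSS.
rewrite coef_merge coef_prepend_neq ?add0r; last by rewrite eq_sym addp_neq.
rewrite coef_qF.
have -> : refines (addp pos1 b :: be) (addp pos1 a :: al) =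
          refines (b :: be) (a :: al).
  case: (posnat_cmpP a b) => [|c|{}b c ->].
  - by rewrite !refines_cons_same.
  - by rewrite addpA !refines_addp_cons.
  by rewrite addpA !refines_cons_addp.
case: ifP => [h|]; rewrite ?mulr0 // -exprS; congr ('X^_).
have := size_weight (b :: be); rewrite (refines_weight _ _ h) !weight_cons /=.
by lia.
Qed.

(** * Products split by the origin of their first entry *)

(* The part of [x * y] in which the first entry comes from [x] alone. *)
Definition headmul (x y : Q) : Q :=
  mlift (fun al => if al is b :: al' then prepend b (qM al' * y) else 0) x.

Lemma headmul_nil y : headmul (qM [::]) y = 0.
Proof. exact: mliftU. Qed.

Lemma headmul_cons b al y :
  headmul (qM (b :: al)) y = prepend b (qM al * y).
Proof. exact: mliftU. Qed.

Lemma headmulP (c : {poly R}) x y z :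
  headmul (c *: x + y) z = c *: headmul x z + headmul y z.
Proof. exact: linearP. Qed.

(** If the first entry of a term does not come from [x] alone, it is [c], alone or added to the
    first entry of [x]; [attach c x] collects these two possibilities. *)
Lemma mul_prependr x c y : x * prepend c y =
  headmul (attach c x) y + headmul x (prepend c y).
Proof.
move: x; apply: malg_linear_ext => [a u v|a u v|[|b al]].
- by rewrite mulrDl scalerAl.
- by rewrite linearP !headmulP scalerDr addrACA.
- rewrite -/(qM [::]) headmul_nil addr0 qM_nil mul1r /attach merge_nil scaler0.
  by rewrite addr0 prependM headmul_cons mul1r.
rewrite -/(qM (b :: al)) headmul_cons /attach merge_cons prependM.
rewrite [X in headmul X y]addrC headmulP !headmul_cons -!(prependM _ b al).
rewrite [LHS]qmul_prepend (addpC c b) [RHS]addrC -[LHS]addrA.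
by congr (_ + _); rewrite addrC.
Qed.

Lemma mulr1_headmul x : x = headmul x 1 + counit x *: 1.
Proof.
move: x; apply: malg_linear_ext => [a u v|a u v|[|b al]] //.
- by rewrite headmulP /counit mcoeffD mcoeffZ scalerDl -scalerA scalerDr addrACA.
- by rewrite -/(qM [::]) headmul_nil add0r counitM scale1r.
by rewrite -/(qM (b :: al)) headmul_cons counitM scale0r addr0 mulr1 prependM.
Qed.

Lemma counit_attach a x : counit (attach a x) = 0.
Proof.
by rewrite /counit mcoeffD mcoeffZ coef_prepend_nil coef_merge_nil mulr0 addr0.
Qed.

(** The accumulator [x] is arbitrary so that induction on [al] can pass to [attach c x]. The
    [headmul (attach c x)] part of the first term then cancels the rest of the sum. *)
Lemma sum_attach_telescope x al :
  \sum_(k < (size al).+1)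
    (-1) ^+ k *: (foldl (fun y a => attach a y) x (take k al) * qM (drop k al))
  = headmul x (qM al) + (if al is [::] then counit x *: 1 else 0).
Proof.
elim: al x => [|c al IHal] x.
  by rewrite big_ord1 scale1r mulr1 -mulr1_headmul.
rewrite big_ord_recl /= scale1r -prependM mul_prependr prependM addr0.
under eq_bigr => k _ do rewrite exprS mulN1r scaleNr.
rewrite sumrN IHal counit_attach scale0r.
by case: (al) => [|d be]; rewrite addr0 addrAC subrr add0r.
Qed.

Lemma qE_rev al : qE R (rev al) = foldl (fun y a => attach a y) 1 al.
Proof.
rewrite -[al in RHS]revK foldl_rev.
by elim: (rev al) => [|a be IH] /=; rewrite ?qE_nil // qE_cons IH.
Qed.

(** * The antipode on monomials *)

Lemma antipode_unique (S : {linear Q -> Q}) (f : composition -> Q) :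
  is_antipode S ->
  (forall al, \sum_(k < (size al).+1) f (take k al) * qM (drop k al)
              = (al == [::])%:R) ->
  forall al, S (qM al) = f al.
Proof.
move=> antiS fP al; have [m] := ubnP (size al); elim: m al => // m IHm al alm.
(* In the left antipode relation the last term is [S (qM al)] times 1; all others involve proper
   prefixes. *)
have [+ _] := antiS (qM al).
rewrite convolutionM counitM scaler_nat -fP !big_ord_recr /=.
rewrite take_size drop_size !mulr1 => /eqP.
rewrite (eq_bigr (fun k : 'I_(size al) => f (take k al) * qM (drop k al))).
  by rewrite (inj_eq (addrI _)) => /eqP.
move=> k _; rewrite IHm // size_take ltn_ord.
exact: leq_trans (ltn_ord k) _.
Qed.

Lemma antipode_qM (S : {linear Q -> Q}) al : is_antipode S ->
  S (qM al) = (-1) ^+ size al *: qE R (rev al).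
Proof.
move=> antiS.
apply: (@antipode_unique S (fun al => (-1) ^+ size al *: qE R (rev al))) => // {}al.
(* Telescoping starts at 1, which has no first entry: its [headmul] vanishes and only the counit
   term remains. *)
transitivity (headmul 1 (qM al) +
  (if al is [::] then counit (1 : Q) *: (1 : Q) else 0)).
  rewrite -sum_attach_telescope; apply: eq_bigr => k _.
  rewrite scalerAl qE_rev; congr (_ *: _ * _).
  by rewrite size_take_min (minn_idPl _) // -ltnS.
rewrite -qM_nil headmul_nil add0r counitM; case: al => //=.
by rewrite scale1r.
Qed.

(** * Reversal and the antipode on [qF] *)

Definition qrev : Q -> Q := mlift (fun al => qM (rev al)).
HB.instance Definition _ := GRing.Linear.on qrev.

Lemma qrevM al : qrev (qM al) = qM (rev al).
Proof. exact: mliftU. Qed.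

Lemma qrevK : involutive qrev.
Proof.
apply: malg_linear_ext => [c x y|c x y|al] //; first by rewrite !linearP.
by rewrite -/(qM al) !qrevM revK.
Qed.

Lemma coef_qrev x be : (qrev x)@_be = x@_(rev be).
Proof.
apply: mlift_coef => al; rewrite coef_qM; congr (_ : bool)%:R.
exact: (can2_eq revK revK).
Qed.

Lemma qrev_qF al : qrev (qF R al) = qF R (rev al).
Proof.
apply/malgP => be; rewrite coef_qrev !coef_qF weight_rev size_rev.
by rewrite -refines_rev revK.
Qed.

Lemma qrev_qE al : qrev (qE R al) = qE R (rev al).
Proof.
apply/malgP => be; rewrite coef_qrev !coef_qE !size_rev.
by rewrite -refines_rev revK.
Qed.

Section Antipode.
Variable S : {linear Q -> Q}.
Hypothesis antiS : is_antipode S.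

Let T x := qrev (S x).

Let TM al : T (qM al) = (-1) ^+ size al *: qE R al.
Proof. by rewrite /T antipode_qM // linearZ /= qrev_qE revK. Qed.

Let TP : linear T.
Proof. by move=> c x y; rewrite /T !linearP. Qed.

Let T_prepend a x : T (prepend a x) = - attach a (T x).
Proof.
move: x; apply: malg_linear_ext => [c x y|c x y|al].
- by rewrite linearP TP.
- by rewrite TP linearP opprD scalerN.
by rewrite -/(qM al) prependM !TM linearZ /= qE_cons exprS mulN1r scaleNr.
Qed.

Let T_merge a x : counit x = 0 -> T (merge a x) = merge a (T x).
Proof.
(* Writing [x] as [headmul x 1] builds the vanishing counit into the expression, so linear extension
   from the basis applies. *)
move=> x0; rewrite (mulr1_headmul x) x0 scale0r addr0.
move: x {x0}; apply: malg_linear_ext => [c x y|c x y|[|b al]].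
- by rewrite headmulP linearP TP.
- by rewrite headmulP TP linearP.
- by rewrite -/(qM [::]) headmul_nil /T !linear0.
rewrite -/(qM (b :: al)) headmul_cons mulr1 prependM merge_cons !TM.
by rewrite linearZ /= !qE_cons merge_attach.
Qed.

(** The term ['X *: merge a (T x)] cancels the merging part of [T (prepend a x)]. *)
Let T_attach a x : counit x = 0 -> T (attach a x) = - prepend a (T x).
Proof.
move=> x0; rewrite /attach addrC TP T_merge // T_prepend /attach.
by rewrite opprD addrCA subrr addr0.
Qed.

Let T_qF al : T (qF R al) = (-1) ^+ weight al *: qF R (complement al).
Proof.
have [m] := ubnP (weight al); elim: m al => // m IHm [|a al].
  by move=> _; rewrite /complement comp0 qF_nil -qM_nil TM qE_nil.
case: (posnatP a) => [|{}a]; last first.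
  rewrite weight_cons /= -addnA -weight_cons => alm.
  rewrite qF_consS T_attach; last by rewrite /counit coef_qF refines_nill.
  rewrite IHm //; rewrite complementS qF_cons1 linearZ /=.
  by rewrite exprS mulN1r scaleNr.
rewrite weight_cons /= => alm; rewrite qF_cons1 T_prepend IHm //.
rewrite linearZ /= exprS mulN1r scaleNr.
(* The complement is empty only for empty [al]; then the single cell is its own complement, and
   [merge] kills 1. *)
case cE: (complement al) => [|b be].
  move/eqP: (cE); rewrite complement_eq0 => /eqP ->.
  have -> : complement [:: pos1] = [:: pos1].
    apply: set_of_comp_inj => [|t]; first exact: weight_complement.
    by rewrite mem_complement set_of_comp_cons /=; case: t => [|[|]].
  by rewrite qF_cons1 qF_nil /attach -qM_nil merge_nil scaler0 addr0.
by rewrite (complement1 _ _ _ cE) qF_consS.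
Qed.

Lemma antipode_qF al : S (qF R al) = (-1) ^+ weight al *: qF R (transpose al).
Proof.
by rewrite -[LHS]qrevK -/(T _) T_qF linearZ /= qrev_qF transposeE.
Qed.

End Antipode.

End Operators.

Theorem theorem3p3 (R : comNzRingType) (S : {linear QSym R -> QSym R})
    (n : nat) (alpha : composition) :
  is_antipode S -> weight alpha = n ->
  S (qF R alpha) = (-1) ^+ n *: qF R (transpose alpha)
  /\ S (qM alpha) = (-1) ^+ size alpha *: qE R (rev alpha).
Proof. by move=> antiS <-; rewrite antipode_qF // antipode_qM. Qed.
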